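(* Let $I\subset\mathbb{R}$ be a closed interval and $p\in(0,1)$. There exist continuous maps $f^\star,g^\star:I\to I$ that are both distributionally chaotic, i.e. $\mu(f^\star)>0$ and $\mu(g^\star)>0$, such that the random dynamical system that applies $f^\star$ with probability $p$ and $g^\star$ with probability $1-p$ at each step is not distributionally chaotic, i.e. $\mu(f^\star,g^\star,p)=0$.
   Context: $I$ is a closed bounded interval of length $|I|>0$. Deterministic case: for $f:I\to I$ and $x,y\in I$ let $F_{xy}^{(n)}(t)=\frac1n\#\{i\in\{0,\ldots,n-1\}:|f^i(x)-f^i(y)|<t\}$ ($f^i$ is the $i$-th iterate), $F_{xy}=\liminf_{n\to\infty}F_{xy}^{(n)}$, $F_{xy}^\star=\limsup_{n\to\infty}F_{xy}^{(n)}$ pointwise, and $\mu(f)=\sup_{x,y\in I}\frac1{|I|}\int_0^{|I|}(F_{xy}^\star(t)-F_{xy}(t))\,\mathrm{d}t$. Random case: for $f,g:I\to I$ and $p\in[0,1]$, $\Omega=\{f,g\}^{\infty}$ carries the product probability measure $P$ under which the coordinates $\omega_1,\omega_2,\ldots$ are independent with $P(\omega_i=f)=p$, $P(\omega_i=g)=1-p$ ($f$ and $g$ being treated as two distinct symbols). For $x\in I$ put $x_0=x$, $x_n(\omega)=\omega_n\circ\cdots\circ\omega_1(x)$; for two starting points $x,y$ the trajectories are driven by the same $\omega$. Here $F_{xy}^{(n)}(t)=\frac1n\sum_{i=0}^{n-1}P(|x_i-y_i|<t)$, $F_{xy}=\liminf_{n\to\infty}F_{xy}^{(n)}$, $F_{xy}^\star=\limsup_{n\to\infty}F_{xy}^{(n)}$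 pointwise, and $\mu(f,g,p)=\sup_{x,y\in I}\frac1{|I|}\int_0^{|I|}(F_{xy}^\star(t)-F_{xy}(t))\,\mathrm{d}t$. *)

(* Defs.v *)
From HB Require Import structures.
From mathcomp Require Import all_boot all_order all_algebra.
From mathcomp Require Import all_classical all_reals all_analysis.
From mathcomp Require Import measurable_realfun.
Import Order.TTheory GRing.Theory Num.Theory.
Import numFieldNormedType.Exports.

Set Implicit Arguments.
Unset Strict Implicit.
Unset Printing Implicit Defensive.

Local Open Scope classical_set_scope.
Local Open Scope ring_scope.

(* Sequences of symbols: [true] stands for [f] and [false] for [g], so that the
   two symbols stay distinct even when [f = g].  Coordinates are numbered from 0.
   The sigma-algebra is the product one, generated by the sets [{w | w i = s}]. *)
Definition coordinate_sets : set (set (nat -> bool)) :=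
  [set [set w | w i = s] | i in [set: nat] & s in [set: bool]].

Definition symbol_seq := g_sigma_algebraType coordinate_sets.

Section product_probability.
Context (R : realType).
Local Open Scope ereal_scope.

Definition independent_coordinates (P : set symbol_seq -> \bar R) :=
  forall (J : seq nat) (A : nat -> set bool), uniq J ->
    P [set w | forall i, i \in J -> A i (w i)] =
    \prod_(i <- J) P [set w | A i (w i)].

Definition is_product_probability (p : R) (P : set symbol_seq -> \bar R) :=
  [/\ forall i, P [set w | w i = true] = p%:E,
      forall i, P [set w | w i = false] = (1 - p)%:E
    & independent_coordinates P].

End product_probability.

(* Existence of the product probability: it is the image of the Lebesgue measure
   on [0, 1[ under the itinerary map of the piecewise affine map [step] with
   respect to the pieces [0, p[ and [p, 1[. *)
Section existence.
Context (R : realType).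
Local Notation mu := (@lebesgue_measure R).
Local Notation RR := (measurableTypeR R).

Let aff (c r : R) : RR -> RR := fun x => (x - c) / r.

Let measurable_aff c r : measurable_fun setT (aff c r).
Proof. by apply: measurable_funM => //; apply: measurable_funB. Qed.

Let lebesgue_aff (c r : R) (A : set RR) : 0 < r -> measurable A ->
  mu (aff c r @^-1` A) = (r%:E * mu A)%E.
Proof.
move=> r0 mA; have rV0 : 0 <= r^-1 by rewrite invr_ge0 ltW.
pose nu : {measure set RR -> \bar R} := pushforward mu (aff c r).
have -> : mu A = mscale (NngNum rV0) (nu (measurable_aff c r)) A.
  apply: lebesgue_measure_unique => // _ [[a b]] _ <-.
  have E : aff c r @^-1` `]a, b]%classic = `](r * a + c), (r * b + c)]%classic.
    apply/seteqP; split=> x; rewrite /= !in_itv/= /aff.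
      by rewrite ltr_pdivlMr// ler_pdivrMr// !(mulrC r) ltrBrDr lerBlDr.
    by rewrite ltr_pdivlMr// ler_pdivrMr// !(mulrC r) ltrBrDr lerBlDr.
  rewrite -[RHS]/(r^-1%:E * mu (aff c r @^-1` `]a, b]%classic))%E E.
  rewrite !lebesgue_measure_itv/= !lte_fin ltrD2r ltr_pM2l//.
  case: ifPn => _; last by rewrite mule0.
  rewrite -EFinB -EFinM; congr EFin.
  by rewrite opprD addrACA subrr addr0 -mulrBr mulKf// gt_eqF.
rewrite -[mscale _ _ _]/(r^-1%:E * mu (aff c r @^-1` A))%E muleA -EFinM divff ?mul1e// gt_eqF//.
Qed.

Context (p : R) (p01 : 0 <= p <= 1).

Let mI : measurable (`[0, 1[%classic : set RR).
Proof. exact: measurable_itv. Qed.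

Let U := mrestr mu mI.

Let U_setT : U setT = 1%E.
Proof.
by rewrite /U /mrestr setTI lebesgue_measure_itv/= lte01 oppr0 adde0.
Qed.

Let sym (x : RR) : bool := x < p.
Let step (x : RR) : RR := if sym x then aff 0 p x else aff p (1 - p) x.
Let itinerary (x : RR) : symbol_seq := fun i => sym (iter i step x).

Let measurable_sym : measurable_fun setT sym.
Proof. exact: measurable_fun_ltr. Qed.

Let measurable_step : measurable_fun setT step.
Proof. by apply: measurable_fun_ifT. Qed.

Let measurable_iter i : measurable_fun setT (iter i step).
Proof.
elim: i => [|i IH]; first exact: measurable_id.
exact: (measurableT_comp measurable_step IH).
Qed.

Let measurable_itinerary : measurable_fun setT itinerary.
Proof.
apply: (measurability _ (erefl : @measurable _ symbol_seq = <<s coordinate_sets >>)).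
move=> _ [_ [i _ [s _ <-]] <-].
rewrite setTI.
have := measurableT_comp measurable_sym (measurable_iter i).
by move=> /(_ measurableT [set s] I); rewrite setTI.
Qed.

Let q (A : set bool) : R := (true \in A)%:R * p + (false \in A)%:R * (1 - p).

Let U_true B : measurable B ->
  U ([set x | sym x = true] `&` step @^-1` B) = (p%:E * U B)%E.
Proof.
move=> mB; case/andP: p01; rewrite le_eqVlt => /predU1P[p0|p0] p1.
  rewrite -p0 mul0e /U /mrestr -(measure0 mu); congr (mu _).
  apply/seteqP; split=> x //= [[+ _]]; rewrite in_itv/= /sym -p0 => x0.
  by rewrite leNgt x0.
rewrite [in RHS]/U /mrestr -(lebesgue_aff 0)//; last exact: measurableI.
rewrite /U /mrestr; congr (mu _); apply/seteqP; split=> x.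
  rewrite /= /step => -[[xp]]; rewrite xp in_itv/= => xB /andP[x0 x1].
  split=> //; rewrite in_itv/= /aff subr0 divr_ge0 ?(ltW p0)//=.
  by rewrite ltr_pdivrMr// mul1r.
rewrite /= /step in_itv/= /aff subr0 => -[xB /andP[x0 x1]].
have xp : sym x by rewrite ltr_pdivrMr// mul1r in x1.
split; first by rewrite xp.
rewrite in_itv/= (lt_le_trans xp)// andbT.
by rewrite pmulr_lge0 ?invr_gt0 in x0.
Qed.

Let U_false B : measurable B ->
  U ([set x | sym x = false] `&` step @^-1` B) = ((1 - p)%:E * U B)%E.
Proof.
move=> mB; case/andP: p01 => p0; rewrite le_eqVlt => /predU1P[p1|p1].
  rewrite p1 subrr mul0e /U /mrestr -(measure0 mu); congr (mu _).
  apply/seteqP; split=> x //= [[+ _]]; rewrite in_itv/= /sym p1 => x1.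
  by rewrite x1 andbF.
have q0 : 0 < 1 - p by rewrite subr_gt0.
rewrite [in RHS]/U /mrestr -(lebesgue_aff p)//; last exact: measurableI.
rewrite /U /mrestr; congr (mu _); apply/seteqP; split=> x.
  rewrite /= /step => -[[xp]]; rewrite xp in_itv/= => xB /andP[x0 x1].
  have px : p <= x by rewrite leNgt; apply/negbT.
  split=> //; rewrite in_itv/= /aff divr_ge0 ?subr_ge0 ?(ltW p1)//=.
  by rewrite ltr_pdivrMr// mul1r ltrD2r.
rewrite /= /step in_itv/= /aff => -[xB /andP[x0 x1]].
have px : p <= x by rewrite pmulr_lge0 ?invr_gt0// subr_ge0 in x0.
have xp : sym x = false by apply/negbTE; rewrite -leNgt.
split; first by rewrite xp.
rewrite in_itv/= (le_trans p0 px)/=.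
by rewrite ltr_pdivrMr// mul1r ltrD2r in x1.
Qed.

Let U_step (A : set bool) B : measurable B ->
  U ([set x | A (sym x)] `&` step @^-1` B) = ((q A)%:E * U B)%E.
Proof.
move=> mB.
have mC s : measurable ([set x | sym x = s] `&` step @^-1` B).
  apply: measurableI; rewrite -[X in measurable X]setTI.
  - exact: (measurable_sym measurableT (_ : measurable [set s])).
  - exact: measurable_step.
have := U_true mB; have := U_false mB; rewrite /q.
case: (boolP (true \in A)) => At; case: (boolP (false \in A)) => Af;
  rewrite ?(mul0r, mul1r, add0r, addr0) => UF UT.
- transitivity (U (([set x | sym x = true] `&` step @^-1` B) `|`
      ([set x | sym x = false] `&` step @^-1` B))).
    rewrite -setIUl; congr (U (_ `&` _)); apply/seteqP; split=> x /=.
      by case: (sym x); [left|right].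
    by case=> ->; [exact: (set_mem At)|exact: (set_mem Af)].
  transitivity (U ([set x | sym x = true] `&` step @^-1` B) +
      U ([set x | sym x = false] `&` step @^-1` B))%E.
    apply: (@measureU _ _ _ (mrestr mu mI) _ _ (mC true) (mC false)).
    by apply/seteqP; split=> x //= [[-> _]] [].
  case/andP: p01 => p0 p1.
  by rewrite UT UF [in RHS](EFinD p) ge0_muleDl ?lee_fin ?subr_ge0.
- rewrite -UT; congr (U (_ `&` _)); apply/seteqP; split=> x /=.
    by case: (sym x) => // Af'; rewrite notin_setE in Af.
  by move=> ->; exact: (set_mem At).
- rewrite -UF; congr (U (_ `&` _)); apply/seteqP; split=> x /=.
    by case: (sym x) => // At'; rewrite notin_setE in At.
  by move=> ->; exact: (set_mem Af).
- rewrite mul0e -(measure0 mu) /U /mrestr; congr (mu _).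
  apply/seteqP; split=> x //= [[+ _] _].
  by case: (sym x) => // H; [rewrite notin_setE in At | rewrite notin_setE in Af].
Qed.

Let cylinder n (A : nat -> set bool) : set symbol_seq :=
  [set w | forall i, (i < n)%N -> A i (w i)].

Let measurable_coordinate i (A : set bool) :
  measurable ([set w | A (w i)] : set symbol_seq).
Proof.
rewrite [X in measurable X](_ : _ =
    \bigcup_(s in A) ([set w | w i = s] : set symbol_seq)).
  apply: fin_bigcup_measurable => // s _.
  by apply: sub_sigma_algebra; exists i => //; exists s.
by apply/seteqP; split=> w /=; [exists (w i)|case=> s As ->].
Qed.

Let measurable_cylinder n A : measurable (cylinder n A).
Proof.
rewrite (_ : cylinder n A = \bigcap_(i in `I_n) [set w | A i (w i)])//.
by apply: bigcap_measurableType => i _; exact: measurable_coordinate.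
Qed.

Let U_cylinder n A :
  U (itinerary @^-1` cylinder n A) = (\prod_(i < n) q (A i))%:E.
Proof.
elim: n A => [|n IH] A.
  rewrite big_ord0 -U_setT; congr (U _).
  by apply/seteqP; split.
rewrite big_ord_recl EFinM -(IH (fun i => A i.+1)) -U_step.
  congr (U _); apply/seteqP; split=> x /= Ax.
    split; first exact: (Ax 0%N).
    by move=> i ni; have := Ax i.+1 ni; rewrite /itinerary iterSr.
  by case=> [_|i ni]; [exact: Ax.1|rewrite /itinerary iterSr; exact: Ax.2].
by rewrite -[X in measurable X]setTI; exact: measurable_itinerary.
Qed.

Let qT : q setT = 1.
Proof. by rewrite /q !in_setT !mul1r addrC subrK. Qed.

Let U_independent (J : seq nat) (A : nat -> set bool) : uniq J ->
  U (itinerary @^-1` [set w | forall i, i \in J -> A i (w i)]) =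
  (\prod_(i <- J) q (A i))%:E.
Proof.
move=> uJ; pose n := (\max_(i <- J) i).+1.
have Jn i : i \in J -> (i < n)%N.
  by move=> iJ; rewrite ltnS; exact: leq_bigmax_seq.
pose A' i := if i \in J then A i else setT.
transitivity (U (itinerary @^-1` cylinder n A')).
  congr (U _); apply/seteqP; split=> x /= Ax i; first rewrite /A'.
    by case: ifPn => // iJ _; exact: Ax.
  by move=> iJ; have := Ax i (Jn _ iJ); rewrite /A' iJ.
rewrite U_cylinder; congr EFin.
rewrite -(big_mkord xpredT (fun i => q (A' i))).
rewrite (bigID (mem J))/= [X in _ * X]big1 ?mulr1; last first.
  by move=> i /negbTE iJ; rewrite /A' iJ qT.
rewrite -big_filter; apply: etrans (_ : \prod_(i <- J) q (A' i) = _).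
  apply: perm_big; apply: uniq_perm => //; first by rewrite filter_uniq ?iota_uniq.
  move=> i; rewrite mem_filter mem_index_iota/=.
  by case: (boolP (i \in J)) => // /Jn ->.
by apply: eq_big_seq => i iJ; rewrite /A' iJ.
Qed.

Let U_coordinate i (A : set bool) :
  U (itinerary @^-1` [set w | A (w i)]) = (q A)%:E.
Proof.
have := @U_independent [:: i] (fun=> A) isT; rewrite big_seq1 => <-.
congr (U _); apply/seteqP; split=> x /= Ax.
  by move=> j; rewrite inE => /eqP ->.
by apply: Ax; rewrite inE.
Qed.

Lemma product_probability_exists :
  exists P : probability symbol_seq R, is_product_probability p P.
Proof.
pose nu : {measure set symbol_seq -> \bar R} := pushforward (mrestr mu mI) itinerary.
pose m := nu measurable_itinerary.
have mT : m setT = 1%E by exact: U_setT.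
pose P := HB.pack_for (probability symbol_seq R) (Measure.sort m) m
  (Measure_isProbability.Build _ _ _ m mT).
have PE (B : set symbol_seq) : P B = U (itinerary @^-1` B) by [].
exists P; split=> [i|i|J A uJ].
- rewrite PE (U_coordinate i [set true]) /q.
  by rewrite mem_set// memNset// mul1r mul0r addr0.
- rewrite PE (U_coordinate i [set false]) /q.
  by rewrite memNset// mem_set// mul1r mul0r add0r.
- rewrite PE U_independent// -prodEFin; apply: eq_bigr => i _.
  by rewrite PE U_coordinate.
Qed.

End existence.

(* The product probability of [{f, g}^oo] with [P(w i = f) = p]; outside
   [0 <= p <= 1] there is none and the value is an irrelevant Dirac mass. *)
Definition product_probability (R : realType) (p : R) :
    probability symbol_seq R :=
  if pselect (exists P : probability symbol_seq R, is_product_probability p P)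
    is left ex then projT1 (cid ex) else \d_(point : symbol_seq).

Lemma product_probabilityP (R : realType) (p : R) : 0 <= p <= 1 ->
  is_product_probability p (product_probability p).
Proof.
move=> p01; rewrite /product_probability; case: pselect => [ex|[]].
  exact: (projT2 (cid ex)).
exact: product_probability_exists.
Qed.

Section distributional_chaos.
Context (R : realType) (a b : R).
Implicit Types (f g : R -> R) (x y t p : R) (n : nat).

(* The quantity [sup_{x, y in I} |I|^-1 int_0^|I| (F*_xy - F_xy)] for
   [I = [a, b]], where [F x y n t] is the n-th distribution function
   [F_xy^(n)(t)].  It is valued in the extended reals, but all [F x y n t] used
   below lie in [0, 1]. *)
Definition chaos_measure (F : R -> R -> nat -> R -> \bar R) : \bar R :=
  ereal_sup [set (b - a)^-1%:E *
      \int[lebesgue_measure]_(t in `[0%R, (b - a)%R])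
        (limn_esup (fun n => F x y n t) - limn_einf (fun n => F x y n t))
    | x in `[a, b] & y in `[a, b]]%E.

Definition orbit_distribution f x y n t : \bar R :=
  (n%:R^-1 * #|[pred i : 'I_n | `|iter i f x - iter i f y| < t]|%:R)%:E.

(* [trajectory f g w x n] is [x_n(w)]. *)
Fixpoint trajectory f g (w : symbol_seq) x n : R :=
  if n is m.+1 then (if w m then f else g) (trajectory f g w x m) else x.

Definition random_distribution f g p x y n t : \bar R :=
  ((n%:R^-1)%:E * \sum_(0 <= i < n)
     product_probability p
       [set w | `|trajectory f g w x i - trajectory f g w y i|%R < t]%R)%E.

Definition mu_map f : \bar R := chaos_measure (orbit_distribution f).

Definition mu_random f g p : \bar R :=
  chaos_measure (random_distribution f g p).

End distributional_chaos.

(* Main.v *)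
Require Import Defs.
From mathcomp Require Import all_boot all_order all_algebra.
From mathcomp Require Import all_classical all_reals all_analysis.
From mathcomp Require Import measurable_realfun ring lra zify.
Import Order.TTheory GRing.Theory Num.Theory.
Import numFieldNormedType.Exports.

Local Open Scope classical_set_scope.
Local Open Scope ring_scope.

(** Let [c] be the midpoint of [I = [a, b]].  The map [f] is a three-branch
    full zigzag on [[a, c]] and is constantly [c] on [[c, b]]; the map [g] is
    its mirror image.  Thus [f] sends [I] into [[a, c]], where [g] is constant,
    and two trajectories merge forever as soon as some [f] is followed, at any
    later time, by a [g].  Hence [P (x_n <> y_n) <= (1 - p)^m + p^m] with
    [m = n./2], and by Cesaro [F_xy^(n)(t)] tends to 1 for every [t > 0].
    On the other hand [f] acts as the shift on a Cantor subset of [[a, c]].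
    The point coded by a 0-1 sequence that is constant on dyadic blocks, with
    alternating values, is close to the fixed point [a] with a frequency that
    oscillates between 1/3 and 2/3, so [mu (f) > 0]. *)

(** * Lower and upper limits, and a criterion for a positive chaos measure *)

Lemma limn_einf_le_frequently (R : realType) (u : (\bar R)^nat) (l : \bar R) :
  (forall N, exists2 n, (N <= n)%N & (u n <= l)%E) -> (limn_einf u <= l)%E.
Proof.
move=> H; rewrite limn_einf_lim; apply: lime_le; first exact: is_cvg_einfs.
apply: nearW => N; have [n Nn un] := H N.
by apply: le_trans un; apply: ereal_inf_lbound; exists n.
Qed.

Lemma limn_esup_ge_frequently (R : realType) (u : (\bar R)^nat) (l : \bar R) :
  (forall N, exists2 n, (N <= n)%N & (l <= u n)%E) -> (l <= limn_esup u)%E.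
Proof.
move=> H; rewrite limn_esup_lim; apply: lime_ge; first exact: is_cvg_esups.
apply: nearW => N; have [n Nn un] := H N.
by apply: le_trans un _; apply: ereal_sup_ubound; exists n.
Qed.

Lemma measurable_fun_limn_einf (d : measure_display) (T : measurableType d)
    (R : realType) (D : set T) (f : (T -> \bar R)^nat) :
  (forall n, measurable_fun D (f n)) ->
  measurable_fun D (fun x => limn_einf (f^~ x)).
Proof.
move=> mf; rewrite (_ : (fun x => _) =
    (fun x => - limn_esup (fun n => - f n x))%E); last first.
  apply/funext => x; rewrite -limn_einfN; congr limn_einf.
  by apply/funext => n /=; rewrite oppeK.
apply: measurableT_comp => //; apply: measurable_fun_limn_esup => n.
exact: measurableT_comp.
Qed.

(** The pair [(x, y)] is the witness: on [[c, d]] the lower limit is at most [l] and the upper limit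
    at least [u], so the integrand is at least [u - l] there and nonnegative elsewhere; this gives
    the lower bound [(u - l) * (d - c) / (b - a)]. Monotonicity of [h n] in [t] supplies
    measurability of the integrand. *)
Lemma chaos_measure_gt0 (R : realType) (a b : R)
    (F : R -> R -> nat -> R -> \bar R) (x y : R) (h : nat -> R -> R)
    (l u c d : R) :
  a < b -> x \in `[a, b] -> y \in `[a, b] ->
  (forall n t, F x y n t = (h n t)%:E) ->
  (forall n, {homo h n : s t / s <= t}) ->
  (forall n t, 0 <= h n t <= 1) ->
  0 <= c -> c < d -> d <= b - a -> l < u ->
  (forall t N, c <= t <= d -> exists2 n, (N <= n)%N & h n t <= l) ->
  (forall t N, c <= t <= d -> exists2 n, (N <= n)%N & u <= h n t) ->
  (0 < chaos_measure a b F)%E.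
Proof.
move=> ab xab yab Fh hmono h01 c0 cd dba lu hl hu.
pose D : set R := `[c, d]%classic; pose I : set R := `[0, b - a]%classic.
have mD : measurable D by exact: measurable_itv.
have mI : measurable I by exact: measurable_itv.
pose G t := (limn_esup (fun n => F x y n t) - limn_einf (fun n => F x y n t))%E.
have mF n : measurable_fun I (F x y n).
  rewrite (_ : F x y n = EFin \o h n); last by apply/funext => t; exact: Fh.
  by apply: measurableT_comp => //; exact: nondecreasing_measurable.
have mG : measurable_fun I G.
  apply: emeasurable_funB; first exact: measurable_fun_limn_esup.
  exact: measurable_fun_limn_einf.
have ID (t : R) : c <= t <= d -> ((u - l)%:E <= G t)%E.
  move=> tcd; rewrite EFinB; apply: leeB.
    apply: limn_esup_ge_frequently => N; have [n Nn un] := hu t N tcd.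
    by exists n => //; rewrite Fh lee_fin.
  apply: limn_einf_le_frequently => N; have [n Nn un] := hl t N tcd.
  by exists n => //; rewrite Fh lee_fin.
have G0 (t : R) : (0 <= G t)%E.
  (* The lower limit lies between 0 and 1, hence is finite; the extended difference is then not an
     indeterminate one. *)
  have einf0 : (0 <= limn_einf (fun n => F x y n t))%E.
    rewrite limn_einf_lim; apply: lime_ge; first exact: is_cvg_einfs.
    apply: nearW => N; apply: le_ereal_inf_tmp => _ [n _ <-].
    by rewrite Fh lee_fin; case/andP: (h01 n t).
  have einf1 : (limn_einf (fun n => F x y n t) <= 1)%E.
    apply: limn_einf_le_frequently => N; exists N => //.
    by rewrite Fh lee_fin; case/andP: (h01 N t).
  have einf_fin : limn_einf (fun n => F x y n t) \is a fin_num.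
    by rewrite fin_real// (lt_le_trans _ einf0)// (le_lt_trans einf1)// ltry.
  by rewrite /G sube_ge0 ?einf_fin//; exact: limn_einf_sup.
apply: (@lt_le_trans _ _ ((b - a)^-1%:E * ((u - l)%:E * (d - c)%:E))%E).
  by rewrite -!EFinM lte_fin !mulr_gt0// ?invr_gt0 subr_gt0.
apply: (@le_trans _ _ ((b - a)^-1%:E * \int[lebesgue_measure]_(t in I) G t)%E);
  last by apply: ereal_sup_ubound; exists x => //; exists y.
apply: lee_wpmul2l; first by rewrite lee_fin invr_ge0 subr_ge0 ltW.
apply: (@le_trans _ _ (\int[lebesgue_measure]_(t in D) (u - l)%:E)%E).
  have muD : lebesgue_measure D = (d - c)%:E.
    by rewrite /D lebesgue_measure_itv/= lte_fin cd.
  by rewrite integral_cst// -muD.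
apply: (@le_trans _ _ (\int[lebesgue_measure]_(t in D) G t)%E).
  apply: ge0_le_integral => //.
  - by move=> t _; rewrite lee_fin subr_ge0 ltW.
  - apply: measurable_funS mG => // t; rewrite /D /I /= !in_itv/=.
    by case/andP=> ? ?; apply/andP; split; lra.
apply: ge0_subset_integral => // t; rewrite /D /I /= !in_itv/=.
by case/andP=> ? ?; apply/andP; split; lra.
Qed.

(** * Densities of a 0-1 sequence constant on dyadic blocks *)

(** Block number [k] consists of the [2 ^ k] indices from [2 ^ k - 1] to [2 ^ k.+1 - 2]; the
    successor under the logarithm makes index 0 the whole block 0. *)
Definition block_parity (i : nat) : bool := odd (trunc_log 2 i.+1).

(** The even blocks among the first [k] have total length 1 + 4 + 16 + ..., a geometric sum;
    [k + odd k] rounds [k] up to an even number. *)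
Lemma sum_even_blocks (k : nat) :
  ((3 * \sum_(0 <= i < (2 ^ k).-1) ~~ block_parity i).+1 = 2 ^ (k + odd k))%N.
Proof.
elim: k => [|k IH]; first by rewrite big_nil.
have k2 : (0 < 2 ^ k)%N by rewrite expn_gt0.
(* Block number [k] is split off; the parity is constantly [odd k] on it. *)
rewrite (@big_cat_nat _ _ _ (2 ^ k).-1)//=; last by rewrite expnS; lia.
rewrite [X in (_ + X)%N](@eq_big_nat _ _ _ _ _ _
  (fun=> nat_of_bool (~~ odd k))).
  rewrite sum_nat_const_nat mulnDr -addSn IH expnS.
  have -> : ((2 * 2 ^ k).-1 - (2 ^ k).-1 = 2 ^ k)%N by lia.
  by rewrite !expnD /=; case: (odd k); rewrite /= ?expnS; lia.
move=> i /andP[i1 i2]; rewrite /block_parity; congr (nat_of_bool (~~ odd _)).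
apply: trunc_log_eq => //; lia.
Qed.

(** Stopping at the end of an odd block, after [2 ^ N.*2 - 1] indices, the even blocks fill exactly
    one third when [N > 0]. *)
Lemma block_parity_density_low (R : realFieldType) (N : nat) :
  exists2 n, (N <= n)%N &
    n%:R^-1 * (\sum_(0 <= i < n) ~~ block_parity i)%:R <= 1 / 3 :> R.
Proof.
have Nk : (N < 2 ^ N.*2)%N by apply: leq_trans (ltn_expl N.*2 (ltnSn 1)); lia.
exists (2 ^ N.*2).-1; first by lia.
have := sum_even_blocks N.*2; rewrite odd_double addn0.
set Z := (\sum_(_ <= _ < _) _)%N; set n := (2 ^ N.*2).-1 => ZE.
have -> : n = (3 * Z)%N by rewrite /n -ZE.
(* [Z = 0] means that the segment is empty; the quotient is then 0. *)
have [->|Z0] := posnP Z; first by rewrite mulr0 divr_ge0.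
rewrite natrM invfM -mulrA mulVf ?pnatr_eq0 -?lt0n//.
by rewrite mulr1 mul1r.
Qed.

(** Stopping at the end of an even block instead gives [3 * Z = 2 * n + 1], slightly more than two
    thirds. *)
Lemma block_parity_density_high (R : realFieldType) (N : nat) :
  exists2 n, (N <= n)%N &
    2 / 3 <= n%:R^-1 * (\sum_(0 <= i < n) ~~ block_parity i)%:R :> R.
Proof.
have Nk : (N.*2.+1 < 2 ^ N.*2.+1)%N by exact: ltn_expl.
exists (2 ^ N.*2.+1).-1; first by lia.
have := sum_even_blocks N.*2.+1; rewrite /= odd_double addn1 [in RHS]expnS.
set Z := (\sum_(_ <= _ < _) _)%N; set n := (2 ^ N.*2.+1).-1 => ZE.
have n0 : (0 < n)%N by lia.
have Zn : (2 * n <= 3 * Z)%N by lia.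
rewrite [leRHS]mulrC ler_pdivlMr ?ltr0n//.
have : (2 * n)%:R <= (3 * Z)%:R :> R by rewrite ler_nat.
by rewrite !natrM; lra.
Qed.

(** * The zigzag map and its shift dynamics on the Cantor set *)

(** On [[0, 1]] this has three full branches of slopes 3, -3, 3; the minimum with 1 adds a plateau
    to the right of 1. The lattice form makes continuity immediate. *)
Definition zigzag {R : realType} (x : R) : R :=
  Num.max (Num.min (3 * x) (2 - 3 * x)) (Num.min (3 * x - 2) 1).

Lemma continuous_zigzag (R : realType) : continuous (@zigzag R).
Proof.
have c3 : continuous (fun x : R => 3 * x) by move=> x; exact: mulrl_continuous.
have cc (c : R) : continuous (fun _ : R => c) by move=> x; exact: cvg_cst.
have c3l : continuous (fun x : R => 2 - 3 * x).
  by move=> x; apply: cvgB; [exact: cc|exact: c3].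
have c3r : continuous (fun x : R => 3 * x - 2).
  by move=> x; apply: cvgB; [exact: c3|exact: cc].
move=> x.
exact: (@continuous_max R R _ _ x
  (@continuous_min R R _ _ x (c3 x) (c3l x))
  (@continuous_min R R _ _ x (c3r x) (cc 1 x))).
Qed.

Lemma zigzag_bounds (R : realType) (x : R) : 0 <= x -> 0 <= zigzag x <= 1.
Proof.
move=> x0; rewrite /zigzag le_max ge_max !le_min !ge_min lexx orbT andbT.
by apply/andP; split; [case: (leP (3 * x) 2) => H; apply/orP; [left|right]|
  apply/orP; case: (leP (3 * x) 1) => H; [left|right]];
  rewrite ?ler01 ?andbT; lra.
Qed.

Lemma zigzag_ge1 (R : realType) (x : R) : 1 <= x -> zigzag x = 1.
Proof.
move=> x1; rewrite /zigzag (@min_r _ _ (3 * x - 2)); last by lra.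
by apply: max_r; rewrite ge_min; apply/orP; right; lra.
Qed.

(** Partial sums of the ternary expansion with digits [2 * s i]; the limits are the points of the
    middle-thirds Cantor set. *)
Definition cantor_sum {R : realType} (s : nat -> bool) (n : nat) : R :=
  \sum_(0 <= i < n) (s i)%:R * 2 / 3 ^+ i.+1.

Definition cantor_point {R : realType} (s : nat -> bool) : R :=
  limn (cantor_sum s).

Section cantor_point_theory.
Context {R : realType}.
Implicit Types (s : nat -> bool) (n : nat).

Lemma cantor_sumS s n :
  cantor_sum s n.+1 = ((s 0%N)%:R * 2 + cantor_sum (s \o S) n) / 3 :> R.
Proof.
rewrite /cantor_sum big_nat_recl// expr1 mulrDl; congr (_ + _).
rewrite big_distrl; apply: eq_bigr => i _ /=.
by rewrite [3 ^+ i.+2]exprSr invfM mulrA.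
Qed.

Lemma cantor_sum_bounds s n : 0 <= (cantor_sum s n : R) <= 1.
Proof.
elim: n s => [|n IH] s; first by rewrite /cantor_sum big_nil lexx ler01.
by rewrite cantor_sumS; have := IH (s \o S); case: (s 0%N) => /=; lra.
Qed.

Lemma is_cvg_cantor_sum s : cvgn (@cantor_sum R s).
Proof.
apply: nondecreasing_is_cvgn.
  apply/nondecreasing_seqP => n.
  by rewrite /cantor_sum big_nat_recr//= lerDl !mulr_ge0// invr_ge0 exprn_ge0.
by exists 1 => _ [n _ <-]; case/andP: (cantor_sum_bounds s n).
Qed.

Lemma cantor_point_bounds s : 0 <= (cantor_point s : R) <= 1.
Proof.
apply/andP; split.
  apply: limr_ge; first exact: is_cvg_cantor_sum.
  by apply: nearW => n; case/andP: (cantor_sum_bounds s n).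
apply: limr_le; first exact: is_cvg_cantor_sum.
by apply: nearW => n; case/andP: (cantor_sum_bounds s n).
Qed.

Lemma cantor_pointE s :
  cantor_point s = ((s 0%N)%:R * 2 + cantor_point (s \o S)) / 3 :> R.
Proof.
apply: (@cvg_lim R) => //; rewrite -cvg_shiftS.
under eq_fun do rewrite cantor_sumS.
apply: cvgMl; apply: cvgD; first exact: cvg_cst.
exact: is_cvg_cantor_sum.
Qed.

(** The first digit places the point in [[0, 1/3]] or in [[2/3, 1]]. On these outer branches the map
    is [3 * x] or [3 * x - 2], which erases the first ternary digit. *)
Lemma zigzag_cantor_point s :
  zigzag (cantor_point s) = cantor_point (s \o S) :> R.
Proof.
have := cantor_point_bounds (s \o S); rewrite (cantor_pointE s) /zigzag.
set z := cantor_point (s \o S); case: (s 0%N) => /andP[z0 z1] /=.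
  rewrite (@min_r _ _ (3 * _)); last by lra.
  by rewrite (@min_l _ _ (3 * _ - 2)) ?max_r; lra.
rewrite (@min_l _ _ (3 * _)); last by lra.
by rewrite (@min_l _ _ (3 * _ - 2)) ?max_l; lra.
Qed.

Lemma iter_zigzag_cantor_point s n :
  iter n zigzag (cantor_point s) = cantor_point (fun i => s (n + i)%N) :> R.
Proof.
elim: n => [//|n IH]; rewrite iterS IH zigzag_cantor_point.
by congr cantor_point; apply/funext => i /=; rewrite addnS addSn.
Qed.

(** Such a threshold lies in the middle gap of the Cantor set, so comparing with it reads off the
    first digit. *)
Lemma cantor_point_lt s (t : R) : 1 / 3 < t <= 2 / 3 ->
  (cantor_point s < t) = ~~ s 0%N.
Proof.
move=> ht; have := cantor_point_bounds (s \o S).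
by rewrite (cantor_pointE s); case: (s 0%N) => /= hz; [apply/negbTE|]; lra.
Qed.

End cantor_point_theory.

(** * The two chaotic maps of [[a, b]] *)

(** The zigzag conjugated by [u |-> a + L * u], with [L] half the length of the interval: the
    plateau becomes the right half. *)
Definition fold_map {R : realType} (a b x : R) : R :=
  a + (b - a) / 2 * zigzag ((x - a) / ((b - a) / 2)).

Definition reflect_map {R : realType} (a b : R) (f : R -> R) (x : R) : R :=
  a + b - f (a + b - x).

Section fold_map_theory.
Context {R : realType} (a b : R) (ab : a < b).
Local Notation L := ((b - a) / 2).

Let L0 : 0 < L. Proof. by rewrite divr_gt0// subr_gt0. Qed.

Lemma continuous_fold_map : continuous (fold_map a b).
Proof.
move=> x; apply: cvgD; first exact: cvg_cst.
apply: cvgMr; apply: (@continuous_comp _ _ _ (fun x => (x - a) / L) zigzag).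
  by apply: cvgMl; apply: cvgB; [exact: cvg_id|exact: cvg_cst].
exact: continuous_zigzag.
Qed.

Lemma fold_map_itv x : x \in `[a, b] -> a <= fold_map a b x <= (a + b) / 2.
Proof.
rewrite in_itv/= => /andP[ax xb]; have /zigzag_bounds : 0 <= (x - a) / L.
  by apply: divr_ge0; [rewrite subr_ge0|exact: ltW].
rewrite /fold_map; set z := zigzag _ => /andP[z0 z1].
have := mulr_ge0 (ltW L0) z0; have := ler_wpM2l (ltW L0) z1.
by rewrite mulr1; set w := L * z; lra.
Qed.

Lemma fold_map_right x : (a + b) / 2 <= x -> fold_map a b x = (a + b) / 2.
Proof.
move=> cx; rewrite /fold_map zigzag_ge1; first by lra.
by rewrite ler_pdivlMr//; lra.
Qed.

Lemma iter_fold_map (u : R) n :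
  iter n (fold_map a b) (a + L * u) = a + L * iter n zigzag u.
Proof.
elim: n => [//|n IH]; rewrite !iterS IH /fold_map addrAC subrr add0r.
by rewrite (mulrC L (iter _ _ _)) mulfK// gt_eqF.
Qed.

(** The fixed point [a] is compared with the Cantor point coded by [block_parity]: the two orbits
    are close at time [i] exactly when [i] lies in an even block. *)
Lemma mu_fold_map_gt0 : (0 < mu_map a b (fold_map a b))%E.
Proof.
pose x := a + L * cantor_point block_parity.
have /andP[c0 c1] := cantor_point_bounds (R := R) block_parity.
have zig0 n : iter n zigzag 0 = 0 :> R.
  elim: n => [//|n IH]; rewrite iterS IH /zigzag mulr0 subr0 min_l//.
  by rewrite sub0r min_l ?max_l; lra.
(* Divided by [L], these thresholds fill [[1/2, 2/3]], an interval of positive length inside the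
   middle gap. *)
have close i t : L / 2 <= t <= L * (2 / 3) ->
    (`|iter i (fold_map a b) x - iter i (fold_map a b) a| < t) =
    ~~ block_parity i.
  move=> /andP[t1 t2].
  have -> : iter i (fold_map a b) a = a.
    by have := iter_fold_map 0 i; rewrite zig0 mulr0 addr0.
  rewrite iter_fold_map iter_zigzag_cantor_point addrAC subrr add0r.
  have /andP[z0 _] :=
    cantor_point_bounds (R := R) (fun j => block_parity (i + j)).
  rewrite ger0_norm; last by apply: mulr_ge0 => //; exact: ltW.
  rewrite mulrC -ltr_pdivlMr//.
  rewrite cantor_point_lt ?addn0// ltr_pdivlMr// ler_pdivrMr//.
  by have := ab; move=> ?; apply/andP; split; lra.
pose h n t : R := n%:R^-1 *
  #|[pred i : 'I_n |
      `|iter i (fold_map a b) x - iter i (fold_map a b) a| < t]|%:R.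
have hE n t : L / 2 <= t <= L * (2 / 3) ->
    h n t = n%:R^-1 * (\sum_(0 <= i < n) ~~ block_parity i)%:R.
  move=> tI; rewrite /h -sum1_card big_mkcond big_mkord; congr (_ * _%:R).
  by apply: eq_bigr => i _; rewrite inE close//; case: block_parity.
apply: (@chaos_measure_gt0 R a b _ x a h
  (1 / 3) (2 / 3) (L / 2) (L * (2 / 3))) => //.
- rewrite in_itv/= /x; have := mulr_ge0 (ltW L0) c0.
  have := ler_wpM2l (ltW L0) c1; rewrite mulr1 => ? ?.
  by apply/andP; split; lra.
- by rewrite in_itv/= lexx ltW.
- move=> n s t st; apply: ler_wpM2l; first by rewrite invr_ge0.
  rewrite ler_nat; apply: subset_leq_card; apply/fintype.subsetP => i.
  by rewrite !inE => /lt_le_trans; apply.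
- move=> n t; rewrite /h mulr_ge0 ?invr_ge0//=.
  have [->|n0] := posnP n; first by rewrite invr0 mul0r.
  rewrite mulrC ler_pdivrMr ?ltr0n// mul1r ler_nat.
  by rewrite -[leqRHS]card_ord max_card.
- by have := ab; lra.
- by have := ab; lra.
- by have := ab; lra.
- lra.
- move=> t N tI; have [n Nn hn] := block_parity_density_low R N.
  by exists n; rewrite ?hE.
- move=> t N tI; have [n Nn hn] := block_parity_density_high R N.
  by exists n; rewrite ?hE.
Qed.

End fold_map_theory.

(** Reflection is an isometry conjugating the two maps, so the reflected pair has the same
    distribution functions. *)
Lemma mu_reflect_map_ge (R : realType) (a b : R) (f : R -> R) :
  (mu_map a b f <= mu_map a b (reflect_map a b f))%E.
Proof.
have refl_itv (x : R) : x \in `[a, b] -> a + b - x \in `[a, b].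
  by rewrite !in_itv/=; lra.
have refl_iter (x : R) n :
    iter n (reflect_map a b f) (a + b - x) = a + b - iter n f x.
  elim: n => [//|n IH]; rewrite !iterS IH /reflect_map.
  by congr (_ - f _); rewrite opprB addrC subrK.
apply: ereal_sup_le => _ [x xab [y yab <-]].
exists (a + b - x); first exact: refl_itv.
exists (a + b - y); first exact: refl_itv.
suff -> : orbit_distribution (reflect_map a b f) (a + b - x) (a + b - y) =
  orbit_distribution f x y by [].
apply/funext => n; apply/funext => t; rewrite /orbit_distribution.
congr ((_ * _%:R)%:E); apply: eq_card => i; rewrite !inE !refl_iter.
rewrite [in RHS]distrC; congr (`|_| < t).
by ring.
Qed.

(** * Probabilities of runs of a single symbol *)

Lemma measurable_coordinate (i : nat) (s : bool) :
  measurable ([set w | w i = s] : set symbol_seq).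
Proof. by apply: sub_sigma_algebra; exists i => //; exists s. Qed.

Lemma product_probability_cylinder (R : realType) (p : R) (m n : nat)
    (s : bool) :
  0 <= p <= 1 -> (m <= n)%N ->
  product_probability p
    [set w | forall i, i \in index_iota m n -> w i = s] =
  ((if s then p else 1 - p) ^+ (n - m))%:E.
Proof.
move=> p01 mn; have [Pt Pf ind] := product_probabilityP p01.
have := ind (index_iota m n) (fun=> [set s]) (iota_uniq _ _) => /= ->.
rewrite -(prodr_const_nat m n) -prodEFin.
by apply: eq_bigr => i _; case: s; [exact: Pt|exact: Pf].
Qed.

Lemma measurable_cylinder (m n : nat) (s : bool) : measurable
  ([set w | forall i, i \in index_iota m n -> w i = s] : set symbol_seq).
Proof.
rewrite (_ : [set w | _] =
    \bigcap_(i in [set i | i \in index_iota m n]) [set w | w i = s])//.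
by apply: bigcap_measurableType => i _; exact: measurable_coordinate.
Qed.

Lemma cvg_half (R : realType) (u : R^nat) (l : R) :
  u @ \oo --> l -> (fun n => u n./2) @ \oo --> l.
Proof.
move=> ul; apply: (@cvg_comp _ _ _ half u _ \oo) => //.
move=> A [N _ NA]; exists N.*2 => // n /= Nn; apply: NA => /=.
by rewrite -(doubleK N) half_leq.
Qed.

(** * Synchronization of random trajectories when [g \o f] is constant on [[a, b]] *)

Section synchronization.
Context {R : realType} (a b : R) (f g : R -> R).
Context (fI : f @` `[a, b] `<=` `[a, b]) (gI : g @` `[a, b] `<=` `[a, b]).
Context (gf : forall x y,
  x \in `[a, b] -> y \in `[a, b] -> g (f x) = g (f y)).
Context (mf : measurable_fun setT f) (mg : measurable_fun setT g).
Implicit Types (x y p : R) (w : symbol_seq) (n m i j : nat).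

Lemma trajectory_itv w x n : x \in `[a, b] -> trajectory f g w x n \in `[a, b].
Proof.
move=> xab; elim: n => [//|n IH] /=.
by case: (w n); [apply: fI|apply: gI]; exists (trajectory f g w x n).
Qed.

Lemma trajectory_sync w x y i j n : x \in `[a, b] -> y \in `[a, b] ->
  (i < j)%N -> (j < n)%N -> w i = true -> w j = false ->
  trajectory f g w x n = trajectory f g w y n.
Proof.
move=> xab yab ij jn wi wj.
(* Invariant after time [i]: the trajectories have merged, or both points lie in the image of [f]. A
   further [f] preserves it, and the next [g] merges them. *)
pose im z := exists2 u, u \in `[a, b] & f u = z.
have near_sync k : (i < k)%N ->
    trajectory f g w x k = trajectory f g w y k \/
    im (trajectory f g w x k) /\ im (trajectory f g w y k).
  elim: k => [//|k IH]; rewrite ltnS leq_eqVlt => /predU1P[<-|/IH{IH}] /=.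
    rewrite wi; right.
    by split; eexists; try reflexivity; exact: trajectory_itv.
  case=> [->|[[u uab <-] [v vab <-]]]; first by left.
  case: (w k); last by left; exact: gf.
  by right; split; eexists; try reflexivity; apply: fI; [exists u|exists v].
have : trajectory f g w x j.+1 = trajectory f g w y j.+1.
  rewrite /= wj; case: (near_sync _ ij) => [->//|[[u ? <-] [v ? <-]]].
  exact: gf.
elim: n jn => [//|n IH]; rewrite ltnS leq_eqVlt => /predU1P[<-//|jn] h.
by rewrite /= (IH jn h).
Qed.

Lemma measurable_trajectory x n :
  measurable_fun setT (fun w : symbol_seq => trajectory f g w x n).
Proof.
elim: n => [|n IH] /=; first exact: measurable_cst.
rewrite (_ : (fun w => _) = (fun w : symbol_seq =>
  if w n then f (trajectory f g w x n)
  else g (trajectory f g w x n))); last first.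
  by apply/funext => w; case: (w n).
apply: measurable_fun_ifT.
- apply: (measurable_fun_bool true); rewrite setTI.
  exact: (measurable_coordinate n true).
- exact: measurableT_comp mf IH.
- exact: measurableT_comp mg IH.
Qed.

Lemma measurable_close x y n (t : R) : measurable
  ([set w | `|trajectory f g w x n - trajectory f g w y n| < t] :
    set symbol_seq).
Proof.
have mh : measurable_fun setT
    (fun w => `|trajectory f g w x n - trajectory f g w y n|).
  apply: measurableT_comp => //.
  by apply: measurable_funB; exact: measurable_trajectory.
rewrite (_ : [set w | _] = setT `&` (fun w : symbol_seq =>
    `|trajectory f g w x n - trajectory f g w y n|) @^-1` `]-oo, t[%classic).
  by apply: mh => //; exact: measurable_itv.
by rewrite setTI; apply/seteqP; split => w /=; rewrite in_itv.
Qed.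

(** If the trajectories differ at time [n], then the first [m = n./2] symbols are all [g] or the
    next [m] are all [f]; otherwise some [f] precedes some [g] before time [n]. *)
Lemma close_probability_ge p x y n (t : R) : 0 <= p <= 1 ->
  x \in `[a, b] -> y \in `[a, b] -> 0 < t ->
  ((1 - ((1 - p) ^+ n./2 + p ^+ n./2))%:E <= product_probability p
    [set w | `|trajectory f g w x n - trajectory f g w y n| < t]%R)%E.
Proof.
move=> p01 xab yab t0; set E := [set w | _]; set m := n./2.
pose A := [set w : symbol_seq | forall i, i \in index_iota 0 m -> w i = false].
pose B :=
  [set w : symbol_seq | forall i, i \in index_iota m m.*2 -> w i = true].
have mE : measurable E by exact: measurable_close.
have mA : measurable A by exact: measurable_cylinder.
have mB : measurable B by exact: measurable_cylinder.
have EAB : ~` E `<=` A `|` B.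
  move=> w nEw; apply: contrapT => /not_orP[nA nB]; apply: nEw.
  have [i [im wi]] : exists i, (i < m)%N /\ w i = true.
    apply: contrapT => h; apply: nA => i; rewrite mem_index_iota => im.
    by apply/negbTE/negP => wi; apply: h; exists i.
  have [j [jm wj]] : exists j, (m <= j < m.*2)%N /\ w j = false.
    apply: contrapT => h; apply: nB => j; rewrite mem_index_iota => jm.
    by apply: contrapT => /negP/negbTE wj; apply: h; exists j.
  have nE : (m.*2 <= n)%N by rewrite -[leqRHS]odd_double_half leq_addl.
  rewrite /E /= (@trajectory_sync w x y i j n) ?subrr ?normr0//; lia.
have : (product_probability p (~` E) <= (((1 - p) ^+ m + p ^+ m)%R)%:E)%E.
  apply: (@le_trans _ _ (product_probability p (A `|` B))).
    apply: le_measure => //; rewrite inE//; last exact: measurableU.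
    exact: measurableC.
  apply: (le_trans (measureU2 _ mA mB)).
  have mm : (m <= m.*2)%N by lia.
  have PA : product_probability p A = ((1 - p) ^+ (m - 0))%:E.
    exact: product_probability_cylinder.
  have PB : product_probability p B = (p ^+ (m.*2 - m))%:E.
    exact: product_probability_cylinder.
  move: PA PB; rewrite subn0 -addnn addnK EFinD => PA PB.
  by apply: leeD; [rewrite -PA|rewrite -PB].
rewrite probability_setC//.
case: (product_probability p E) => [r||]//=; last first.
  by move=> _; rewrite leey.
by rewrite -EFinB !lee_fin; lra.
Qed.

Lemma close_probability_cvg p x y (t : R) : 0 < p < 1 ->
  x \in `[a, b] -> y \in `[a, b] -> 0 < t ->
  fine (product_probability p
    [set w | `|trajectory f g w x n - trajectory f g w y n| < t])
    @[n --> \oo] --> (1 : R).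
Proof.
move=> p01 xab yab t0.
have p01' : 0 <= p <= 1 by lra.
have low : (fun n => 1 - ((1 - p) ^+ n./2 + p ^+ n./2)) @ \oo --> (1 : R).
  rewrite -[X in _ --> X]subr0 -[X in _ --> _ - X]addr0.
  apply: cvgB; first exact: cvg_cst.
  (* Since [0 < p < 1], both [p] and [1 - p] are below 1 and their powers vanish in the limit. *)
  by apply: cvgD; apply: cvg_half; apply: cvg_expr; rewrite ger0_norm; lra.
apply: (@squeeze_cvgr _ _ _ R _ (fun=> 1) _ _ _ low); last exact: cvg_cst.
apply: nearW => n; apply/andP.
have mE := measurable_close x y n t.
have Pfin := fin_num_measure (product_probability p) _ mE.
rewrite -!lee_fin fineK//; split; first exact: close_probability_ge.
exact: probability_le1.
Qed.

(** The distribution functions converge for every [t] of the interval, to 0 at [t = 0] and to 1 for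
    [t > 0]; lower and upper limits agree and each integral vanishes. *)
Lemma mu_random_eq0 p : a < b -> 0 < p < 1 -> mu_random a b f g p = 0%E.
Proof.
move=> ab p01; rewrite /mu_random /chaos_measure.
rewrite (_ : [set _ | _ in _ & _ in _] = [set 0%E]) ?ereal_sup1//.
suff I0 x y : x \in `[a, b] -> y \in `[a, b] ->
    (\int[lebesgue_measure]_(t in `[0%R, (b - a)%R])
        (limn_esup (fun n => random_distribution f g p x y n t) -
         limn_einf (fun n => random_distribution f g p x y n t)))%E = 0%E.
  apply/seteqP; split=> [_ [x xab [y yab <-]]|_ ->].
    by rewrite I0// mule0.
  (* The supremum needs an actual pair, since that of the empty set is minus infinity. *)
  have aab : a \in `[a, b] by rewrite in_itv/= lexx ltW.
  by exists a => //; exists a => //; rewrite I0// mule0.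
move=> xab yab; apply: integral0_eq => t; rewrite /= in_itv/= => /andP[].
rewrite le_eqVlt => /predU1P[<- _|t0 _].
  have F0 : (fun n => random_distribution f g p x y n 0) @ \oo -->
      (0%E : \bar R).
    rewrite (_ : (fun n => _) = cst 0%E); first exact: cvg_cst.
    apply/funext => n; rewrite /random_distribution big1 ?mule0// => i _.
    rewrite (_ : [set w | _] = set0) ?measure0//.
    by apply/seteqP; split => w //=; rewrite normr_lt0.
  by rewrite !(cvg_limn_einf_sup F0) subee.
have F1 : (fun n => random_distribution f g p x y n t) @ \oo --> (1%E : \bar R).
  have := cesaro (close_probability_cvg _ _ _ _ p01 xab yab t0).
  (* The Cesaro mean of index [n] averages [n.+1] terms, hence the shift. *)
  move=> h; rewrite -cvg_shiftS /=.
  apply: (@cvg_trans _ (EFin (arithmetic_mean (fun n =>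
      fine (product_probability p
        [set w | `|trajectory f g w x n - trajectory f g w y n| < t])) n)
      @[n --> \oo]));
    last by apply/fine_cvgP; split; [exact: nearW|exact: h].
  apply: near_eq_cvg; apply: nearW => n.
  rewrite /random_distribution /arithmetic_mean /= EFinM; congr (_ * _)%E.
  rewrite /series /= -sumEFin; apply: eq_bigr => i _.
  by rewrite fineK//; apply: fin_num_measure; exact: measurable_close.
by rewrite !(cvg_limn_einf_sup F1) subee.
Qed.

End synchronization.

Theorem mainTheorem9 (R : realType) (a b p : R) (hab : a < b)
    (hp : 0 < p < 1) :
  exists f g : R -> R,
    [/\ {within `[a, b], continuous f} /\ f @` `[a, b] `<=` `[a, b],
        {within `[a, b], continuous g} /\ g @` `[a, b] `<=` `[a, b],
        (0 < mu_map a b f)%E,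
        (0 < mu_map a b g)%E
      & mu_random a b f g p = 0%E].
Proof.
pose f := fold_map a b; pose g := reflect_map a b f.
have cf : continuous f by exact: continuous_fold_map.
have cg : continuous g.
  move=> x; apply: cvgB; first exact: cvg_cst.
  apply: (@continuous_comp _ _ _ (fun x => a + b - x) f); last exact: cf.
  by apply: cvgB; [exact: cvg_cst|exact: cvg_id].
have fI : f @` `[a, b] `<=` `[a, b].
  move=> _ [x xab <-]; have := fold_map_itv a b hab x xab.
  by rewrite /= in_itv/= /f; lra.
have gI : g @` `[a, b] `<=` `[a, b].
  move=> _ [x xab <-]; rewrite /g /reflect_map.
  have := fI (f (a + b - x)); rewrite /= !in_itv/= => H.
  have : a <= f (a + b - x) <= b.
    by apply: H; exists (a + b - x) => //; move: xab; rewrite /= !in_itv/=; lra.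
  by lra.
(* The value [f x] is at most the midpoint, so its reflection lies on the plateau of [f]; this makes
   [g \o f] constant. *)
have fold_sym x : x \in `[a, b] -> f (a + b - f x) = (a + b) / 2.
  move=> xab; apply: fold_map_right => //.
  by have /andP[_] := fold_map_itv a b hab x xab; rewrite /f; lra.
have gf x y : x \in `[a, b] -> y \in `[a, b] -> g (f x) = g (f y).
  by move=> xab yab; rewrite /g /reflect_map !fold_sym.
have f0 : (0 < mu_map a b f)%E by exact: mu_fold_map_gt0.
have g0 : (0 < mu_map a b g)%E.
  exact: (lt_le_trans f0 (mu_reflect_map_ge R a b f)).
exists f, g; split; [split|split|exact: f0|exact: g0|].
- exact: continuous_subspaceT.
- exact: fI.
- exact: continuous_subspaceT.
- exact: gI.
by apply: mu_random_eq0 => //; exact: continuous_measurable_fun.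
Qed.
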